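(* For all formulas $\phi,\chi$: $\phi\vDash_{\mathrm{ETL}_{\mathbf{M}\omega}}\chi$ if and only if there is a tableaux proof of $\phi\vdash_{\mathrm{ETL}_{\mathbf{M}\omega}}\chi$ (in the calculus for $\mathbf{M}\omega$ described in the context).
   Context: Semantics: $\mathbf{M}\omega$ is the lattice consisting of a top $\top$, a bottom $\bot$, and countably infinitely many pairwise incomparable middle elements $\mathbf{1},\mathbf{2},\ldots,\mathbf{n},\ldots$. Formulas are built from propositional variables using $\neg,\wedge,\vee$; a valuation maps variables to $\mathbf{M}\omega$ and is extended by interpreting $\wedge,\vee$ as meet and join and $\neg$ by $\neg\top=\bot$, $\neg\bot=\top$, $\neg x=x$ for each middle element $x$. $\phi\vDash_{\mathrm{ETL}_{\mathbf{M}\omega}}\chi$ iff for every valuation $v$, $v(\phi)=\top$ implies $v(\chi)=\top$. Tableaux: a tableau is a downward branching tree whose nodes contain labelled formulas $\mathfrak{t}[\phi]$, $\mathfrak{m}[\phi]$, $\mathfrak{f}[\phi]$ and labelled pairs $\phi\sim\chi$, $\phi\nsim\chi$; branches are regarded as sets. A branch containing the premise(s) of a rule may be extended by the rule; conclusions separated by $\mid$ split the branch. Rules ($i\in\{1,2\}$, $p,q,r$ propositional variables, $\circ\in\{\wedge,\vee\}$): $(\mathfrak{t}\wedge)$: $\mathfrak{t}[\phi\wedge\chi]$ / $\mathfrak{t}[\phi],\mathfrak{t}[\chi]$. $(\mathfrak{t}\vee)$: $\mathfrak{t}[\phi\vee\chi]$ / $\mathfrak{t}[\phi]\mid\mathfrak{t}[\chi]\mid\mathfrak{m}[\phi],\mathfrak{m}[\chi],\phi\nsim\chi$.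 $(\mathfrak{t}\neg)$: $\mathfrak{t}[\neg\phi]$ / $\mathfrak{f}[\phi]$. $(\mathfrak{m}\wedge)$: $\mathfrak{m}[\phi\wedge\chi]$ / $\mathfrak{t}[\phi],\mathfrak{m}[\chi]\mid\mathfrak{m}[\phi],\mathfrak{t}[\chi]\mid\mathfrak{m}[\phi],\mathfrak{m}[\chi],\phi\sim\chi$. $(\mathfrak{m}\vee)$: $\mathfrak{m}[\phi\vee\chi]$ / $\mathfrak{f}[\phi],\mathfrak{m}[\chi]\mid\mathfrak{m}[\phi],\mathfrak{f}[\chi]\mid\mathfrak{m}[\phi],\mathfrak{m}[\chi],\phi\sim\chi$. $(\mathfrak{m}\neg)$: $\mathfrak{m}[\neg\phi]$ / $\mathfrak{m}[\phi],\phi\sim\neg\phi$. $(\mathfrak{f}\wedge)$: $\mathfrak{f}[\phi\wedge\chi]$ / $\mathfrak{f}[\phi]\mid\mathfrak{f}[\chi]\mid\mathfrak{m}[\phi],\mathfrak{m}[\chi],\phi\nsim\chi$. $(\mathfrak{f}\vee)$: $\mathfrak{f}[\phi\vee\chi]$ / $\mathfrak{f}[\phi],\mathfrak{f}[\chi]$. $(\mathfrak{f}\neg)$: $\mathfrak{f}[\neg\phi]$ / $\mathfrak{t}[\phi]$. $(\sim\mathsf{sym})$: $\phi\sim\chi$ / $\chi\sim\phi$; $(\nsim\mathsf{sym})$: $\phi\nsim\chi$ / $\chi\nsim\phi$. $(\sim\mathsf{trans})$: $p\sim q,q\sim r$ / $p\sim r$; $(\nsim\mathsf{trans})$: $p\nsim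 q,q\sim r$ / $p\nsim r$. $(\neg\sim)$: $\neg\phi\sim\chi$ / $\phi\sim\chi$; $(\neg\nsim)$: $\neg\phi\nsim\chi$ / $\phi\nsim\chi$. $(\circ\sim)$: $\phi\sim\chi_1\circ\chi_2,\mathfrak{m}[\chi_i]$ / $\phi\sim\chi_i$; $(\circ\nsim)$: $\phi\nsim\chi_1\circ\chi_2,\mathfrak{m}[\chi_i]$ / $\phi\nsim\chi_i$. A branch is closed iff it contains one of: (1) $\mathcal{M}[\phi]$ and $\mathcal{M}'[\phi]$ for distinct labels $\mathcal{M},\mathcal{M}'\in\{\mathfrak{t},\mathfrak{m},\mathfrak{f}\}$; (2) $\phi\sim\chi$ and $\phi\nsim\chi$; (3) $\phi\nsim\phi$. (There is no bound on the number of pairwise $\nsim$-related formulas.) A tableau is closed iff all its branches are closed. There is a tableaux proof of $\phi\vdash_{\mathrm{ETL}_{\mathbf{M}\omega}}\chi$ iff there are closed tableaux beginning with $\{\mathfrak{t}[\phi],\mathfrak{m}[\chi]\}$ and with $\{\mathfrak{t}[\phi],\mathfrak{f}[\chi]\}$. *)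

(* Defs.v *)
(* MathComp world *)
From HB Require Import structures.
From mathcomp Require Import all_boot all_order.

Set Implicit Arguments.
Unset Strict Implicit.
Unset Printing Implicit Defensive.

Import Order.Theory.

(* The middle elements are indexed from 0 rather than from 1. *)
Inductive Mw := MTop | MBot | Mid of nat.

Definition Mw_code (x : Mw) : option (option nat) :=
  match x with MTop => None | MBot => Some None | Mid n => Some (Some n) end.

Definition Mw_decode (c : option (option nat)) : Mw :=
  match c with None => MTop | Some None => MBot | Some (Some n) => Mid n end.

Lemma Mw_codeK : cancel Mw_code Mw_decode.
Proof. by case. Qed.

HB.instance Definition _ := Countable.copy Mw (can_type Mw_codeK).

Definition Mw_le (x y : Mw) : bool := [|| x == MBot, y == MTop | x == y].

Definition Mw_meet (x y : Mw) : Mw :=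
  if Mw_le x y then x else if Mw_le y x then y else MBot.

Definition Mw_join (x y : Mw) : Mw :=
  if Mw_le x y then y else if Mw_le y x then x else MTop.

Lemma Mid_eqE (m n : nat) : (Mid m == Mid n) = (m == n).
Proof. by []. Qed.

Lemma Mw_le_refl : reflexive Mw_le.
Proof. by move=> x; rewrite /Mw_le eqxx !orbT. Qed.

Lemma Mw_le_anti : antisymmetric Mw_le.
Proof. by move=> [||m] [||n] //; rewrite /Mw_le /= => /andP[/eqP ->]. Qed.

Lemma Mw_le_trans : transitive Mw_le.
Proof.
move=> [||n] [||m] [||p] //; rewrite /Mw_le /= !Mid_eqE.
by move=> /eqP ->.
Qed.

Fact Mw_display : Order.disp_t. Proof. exact: Order.Disp tt tt. Qed.

HB.instance Definition _ :=
  Order.Le_isPOrder.Build Mw_display Mw Mw_le_refl Mw_le_anti Mw_le_trans.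

Lemma Mw_lexI (x y z : Mw) :
  Mw_le x (Mw_meet y z) = Mw_le x y && Mw_le x z.
Proof.
rewrite /Mw_meet; case: ifP => [yz|].
  by case xy: (Mw_le x y); rewrite // (Mw_le_trans xy yz).
case: ifP => [zy _|]; first by
  case xz: (Mw_le x z); rewrite ?andbF // (Mw_le_trans xz zy).
case: x y z => [||m] [||n] [||p] //; rewrite /Mw_le /= !Mid_eqE => _ np.
by apply/esym/negP => /andP[/eqP -> /eqP pE]; rewrite pE eqxx in np.
Qed.

Lemma Mw_leUx (x y z : Mw) :
  Mw_le (Mw_join x y) z = Mw_le x z && Mw_le y z.
Proof.
rewrite /Mw_join; case: ifP => [xy|].
  by case yz: (Mw_le y z); rewrite ?andbF // (Mw_le_trans xy yz).
case: ifP => [yx _|]; first by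
  case xz: (Mw_le x z); rewrite // (Mw_le_trans yx xz).
case: x y z => [||m] [||n] [||p] //; rewrite /Mw_le /= !Mid_eqE => _ np.
by apply/esym/negP => /andP[/eqP mE /eqP nE]; rewrite mE nE eqxx in np.
Qed.

HB.instance Definition _ :=
  Order.POrder_isMeetSemilattice.Build Mw_display Mw Mw_lexI.
HB.instance Definition _ :=
  Order.POrder_isJoinSemilattice.Build Mw_display Mw Mw_leUx.

Lemma Mw_le0x (x : Mw) : Mw_le MBot x.
Proof. by []. Qed.

Lemma Mw_lex1 (x : Mw) : Mw_le x MTop.
Proof. by rewrite /Mw_le eqxx orbT. Qed.

HB.instance Definition _ := Order.hasBottom.Build Mw_display Mw Mw_le0x.
HB.instance Definition _ := Order.hasTop.Build Mw_display Mw Mw_lex1.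

Definition Mw_neg (x : Mw) : Mw :=
  match x with MTop => MBot | MBot => MTop | Mid n => Mid n end.

Inductive form :=
  | Var of nat
  | Neg of form
  | And of form & form
  | Or of form & form.

Lemma form_comparable : comparable form.
Proof. by rewrite /comparable /decidable; decide equality; apply: eq_comparable. Qed.

HB.instance Definition _ := hasDecEq.Build form (compareP form_comparable).

Fixpoint eval (v : nat -> Mw) (phi : form) : Mw :=
  match phi with
  | Var p => v p
  | Neg phi => Mw_neg (eval v phi)
  | And phi chi => Order.meet (eval v phi) (eval v chi)
  | Or phi chi => Order.join (eval v phi) (eval v chi)
  end.

Definition ETL_entails (phi chi : form) : Prop :=
  forall v : nat -> Mw,
    eval v phi = Order.top :> Mw -> eval v chi = Order.top :> Mw.

Inductive label := LabT | LabM | LabF.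

Lemma label_comparable : comparable label.
Proof. by rewrite /comparable /decidable; decide equality. Qed.

HB.instance Definition _ := hasDecEq.Build label (compareP label_comparable).

Inductive item :=
  | Lab of label & form
  | Sim of form & form
  | Nsim of form & form.

Lemma item_comparable : comparable item.
Proof. by rewrite /comparable /decidable; decide equality; apply: eq_comparable. Qed.

HB.instance Definition _ := hasDecEq.Build item (compareP item_comparable).

Notation T_ := (Lab LabT).
Notation M_ := (Lab LabM).
Notation F_ := (Lab LabF).

(* [rule prems concls]: the inner lists of [concls] are the alternatives
   separated by bars, each of which is the contents of one new child node. *)
Inductive rule : seq item -> seq (seq item) -> Prop :=
  | rule_tAnd phi chi :
      rule [:: T_ (And phi chi)] [:: [:: T_ phi; T_ chi]]
  | rule_tOr phi chi :
      rule [:: T_ (Or phi chi)]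
        [:: [:: T_ phi]; [:: T_ chi]; [:: M_ phi; M_ chi; Nsim phi chi]]
  | rule_tNeg phi :
      rule [:: T_ (Neg phi)] [:: [:: F_ phi]]
  | rule_mAnd phi chi :
      rule [:: M_ (And phi chi)]
        [:: [:: T_ phi; M_ chi]; [:: M_ phi; T_ chi];
            [:: M_ phi; M_ chi; Sim phi chi]]
  | rule_mOr phi chi :
      rule [:: M_ (Or phi chi)]
        [:: [:: F_ phi; M_ chi]; [:: M_ phi; F_ chi];
            [:: M_ phi; M_ chi; Sim phi chi]]
  | rule_mNeg phi :
      rule [:: M_ (Neg phi)] [:: [:: M_ phi; Sim phi (Neg phi)]]
  | rule_fAnd phi chi :
      rule [:: F_ (And phi chi)]
        [:: [:: F_ phi]; [:: F_ chi]; [:: M_ phi; M_ chi; Nsim phi chi]]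
  | rule_fOr phi chi :
      rule [:: F_ (Or phi chi)] [:: [:: F_ phi; F_ chi]]
  | rule_fNeg phi :
      rule [:: F_ (Neg phi)] [:: [:: T_ phi]]
  | rule_simSym phi chi :
      rule [:: Sim phi chi] [:: [:: Sim chi phi]]
  | rule_nsimSym phi chi :
      rule [:: Nsim phi chi] [:: [:: Nsim chi phi]]
  | rule_simTrans p q r :
      rule [:: Sim (Var p) (Var q); Sim (Var q) (Var r)]
        [:: [:: Sim (Var p) (Var r)]]
  | rule_nsimTrans p q r :
      rule [:: Nsim (Var p) (Var q); Sim (Var q) (Var r)]
        [:: [:: Nsim (Var p) (Var r)]]
  | rule_negSim phi chi :
      rule [:: Sim (Neg phi) chi] [:: [:: Sim phi chi]]
  | rule_negNsim phi chi :
      rule [:: Nsim (Neg phi) chi] [:: [:: Nsim phi chi]]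
  | rule_andSim1 phi chi1 chi2 :
      rule [:: Sim phi (And chi1 chi2); M_ chi1] [:: [:: Sim phi chi1]]
  | rule_andSim2 phi chi1 chi2 :
      rule [:: Sim phi (And chi1 chi2); M_ chi2] [:: [:: Sim phi chi2]]
  | rule_orSim1 phi chi1 chi2 :
      rule [:: Sim phi (Or chi1 chi2); M_ chi1] [:: [:: Sim phi chi1]]
  | rule_orSim2 phi chi1 chi2 :
      rule [:: Sim phi (Or chi1 chi2); M_ chi2] [:: [:: Sim phi chi2]]
  | rule_andNsim1 phi chi1 chi2 :
      rule [:: Nsim phi (And chi1 chi2); M_ chi1] [:: [:: Nsim phi chi1]]
  | rule_andNsim2 phi chi1 chi2 :
      rule [:: Nsim phi (And chi1 chi2); M_ chi2] [:: [:: Nsim phi chi2]]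
  | rule_orNsim1 phi chi1 chi2 :
      rule [:: Nsim phi (Or chi1 chi2); M_ chi1] [:: [:: Nsim phi chi1]]
  | rule_orNsim2 phi chi1 chi2 :
      rule [:: Nsim phi (Or chi1 chi2); M_ chi2] [:: [:: Nsim phi chi2]].

Inductive tree := Node of seq item & seq tree.

Definition contents (t : tree) : seq item := let: Node s _ := t in s.

(* [expansion B t]: when [B] collects the items above [t], every inner node of
   [t] has as children the alternatives of a rule whose premises lie on the
   path from the root of the whole tableau down to that node. *)
Fixpoint expansion (B : seq item) (t : tree) : Prop :=
  let: Node s ts := t in
  (ts = [::] \/
   exists2 prems, {subset prems <= B ++ s} & rule prems (map contents ts)) /\
  foldr (fun u P => expansion (B ++ s) u /\ P) True ts.

Definition tableau_for (start : seq item) (t : tree) : Prop :=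
  contents t = start /\ expansion [::] t.

Fixpoint branches (t : tree) : seq (seq item) :=
  let: Node s ts := t in
  if ts is [::] then [:: s] else [seq s ++ b | b <- flatten (map branches ts)].

Definition closed_branch (b : seq item) : Prop :=
  [\/ exists phi L L', [/\ L != L', Lab L phi \in b & Lab L' phi \in b],
      exists phi chi, Sim phi chi \in b /\ Nsim phi chi \in b
    | exists phi, Nsim phi phi \in b].

Definition closed_tableau (t : tree) : Prop :=
  forall b, b \in branches t -> closed_branch b.

Definition tableaux_proof (phi chi : form) : Prop :=
  (exists t, tableau_for [:: T_ phi; M_ chi] t /\ closed_tableau t) /\
  (exists t, tableau_for [:: T_ phi; F_ chi] t /\ closed_tableau t).

(* Main.v *)
(* Soundness: read [Sim] and [Nsim] as "both values are middle elements, and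
   equal (resp. distinct)"; then every rule has an alternative true under any
   valuation that makes its premises true, so a true root yields a true, hence
   open, branch.
   Completeness: every rule only produces items over subformulas, so adding
   missing alternatives terminates, each resulting branch being closed or
   saturated.  On an open saturated branch, [Sim] is, up to reflexivity, an
   equivalence relation on variables; mapping the variables labelled [LabM]
   injectively by their classes makes all labelled formulas true.  The
   key invariant is that each formula labelled [LabM] has the same value as some
   variable labelled [LabM] that inherits all its [Sim] and [Nsim] items. *)
From mathcomp Require Import all_boot all_order.
From Stdlib Require Import Classical.
Require Import Defs.

Set Implicit Arguments.
Unset Strict Implicit.
Unset Printing Implicit Defensive.

(** * Soundness of the rules under valuations *)

Definition label_of (x : Mw) : label :=
  match x with MTop => LabT | MBot => LabF | Mid _ => LabM end.

Definition sat (v : nat -> Mw) (i : item) : bool :=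
  match i with
  | Lab L f => label_of (eval v f) == L
  | Sim f g => (label_of (eval v f) == LabM) && (eval v f == eval v g)
  | Nsim f g => [&& label_of (eval v f) == LabM, label_of (eval v g) == LabM
                  & eval v f != eval v g]
  end.

Lemma meet_Mid (m n : nat) :
  Order.meet (Mid m) (Mid n) = if m == n then Mid m else MBot.
Proof.
rewrite /Order.meet /= /Mw_meet /Mw_le /= !Mid_eqE.
by rewrite (eq_sym n m); case: (m == n).
Qed.

Lemma join_Mid (m n : nat) :
  Order.join (Mid m) (Mid n) = if m == n then Mid m else MTop.
Proof.
rewrite /Order.join /= /Mw_join /Mw_le /= !Mid_eqE.
by rewrite (eq_sym n m); case: eqP => // ->.
Qed.

(* [label_comparable] is opaque, so equality of labels does not compute. *)
Lemma label_eqE (L L' : label) :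
  (L == L') = match L, L' with
              | LabT, LabT | LabM, LabM | LabF, LabF => true
              | _, _ => false
              end.
Proof. by case: L; case: L'; apply/eqP. Qed.

(** A rule involves the values of at most three formulas, so it suffices to distinguish top, bottom
    and middle for each and then to compare the indices of the middle ones. *)
Lemma rule_sound (v : nat -> Mw) prems concls :
  rule prems concls -> all (sat v) prems -> has (all (sat v)) concls.
Proof.
move=> rl; apply/implyP; case: rl => *; rewrite /= ?andbT ?orbF;
  repeat match goal with
  | |- context [eval v ?f] => move: (eval v f) => [||?]
  | |- context [v ?p] => move: (v p) => [||?]
  end;
  rewrite ?meet_Mid ?join_Mid /= ?Mid_eqE ?eqxx ?label_eqE //=;
  repeat match goal with |- context [?m == ?n] =>
    match type of m with nat =>
      case: (eqVneq m n) => [?|/negbTE ?]; subst;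
      rewrite /= ?Mid_eqE ?eqxx ?label_eqE //=
    end
  end.
by match goal with H : (?n == ?n) = false |- _ => rewrite eqxx in H end.
Qed.

Lemma closed_branch_unsat (v : nat -> Mw) b :
  closed_branch b -> ~~ all (sat v) b.
Proof.
move=> cb; apply/negP => /allP sb; case: cb.
- by case=> f [L [L' [/eqP neqL /sb /eqP fL /sb /eqP fL']]]; case: neqL; rewrite -fL.
- case=> f [g [/sb /andP[_ /eqP e] /sb /and3P[_ _ /eqP]]]; exact.
- by case=> f /sb /and3P[_ _ /eqP].
Qed.

(** The generated principle for [tree] gives no hypothesis for subtrees inside the list of
    children. *)
Lemma tree_nested_ind (P : tree -> Prop) :
  (forall s ts, foldr (fun u Q => P u /\ Q) True ts -> P (Node s ts)) ->
  forall t, P t.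
Proof.
move=> PNode; fix IH 1; case=> s ts; apply: PNode.
by elim: ts => [|u ts IHts] //=; split.
Qed.

(** At each inner node [rule_sound] picks a child whose items are true, and the path continues
    there. *)
Lemma expansion_sound (v : nat -> Mw) t B :
  expansion B t -> all (sat v) (B ++ contents t) ->
  exists2 b, b \in branches t & all (sat v) b.
Proof.
elim/tree_nested_ind: t B => s ts IH B [step exp_ts] satBs.
have sats : all (sat v) s by move: satBs; rewrite all_cat => /andP[].
case: step => [ts0|[prems sub_prems rl]].
  by rewrite ts0; exists s; rewrite //= inE.
have /(rule_sound rl) : all (sat v) prems.
  by apply/allP => i /sub_prems; apply: (allP satBs).
have : forall b, b \in flatten (map branches ts) -> s ++ b \in branches (Node s ts).
  by case: (ts) => // u us b bu; apply: map_f.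
(* The context above the children is abstracted so that it stays fixed during the induction on the
   list of children. *)
move: (B ++ s) (branches _) satBs exp_ts => C bs satC exp_ts sub_bs has_ts.
suff [b b_in satb] : exists2 b, b \in flatten (map branches ts) & all (sat v) b.
  by exists (s ++ b); rewrite ?sub_bs // all_cat sats.
elim: ts IH exp_ts has_ts {rl sub_bs} => //= u us IHus [IHu IH] [exp_u exp_us].
case/orP=> [satu|/(IHus IH exp_us) [b b_in satb]].
  have [|b b_in satb] := IHu C exp_u; first by rewrite all_cat satC.
  by exists b; rewrite // mem_cat b_in.
by exists b; rewrite // mem_cat b_in orbT.
Qed.

Lemma closed_tableau_unsat (v : nat -> Mw) s t :
  tableau_for s t -> closed_tableau t -> ~~ all (sat v) s.
Proof.
move=> [<- exp_t] closed_t; apply/negP => sats.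
have [b b_in satb] := expansion_sound exp_t sats.
by move: (closed_branch_unsat v (closed_t b b_in)); rewrite satb.
Qed.

(** * The valuation read off an open saturated branch *)

Definition saturated (B : seq item) : Prop :=
  forall prems concls, rule prems concls ->
    all [in B] prems -> has (all [in B]) concls.

Section Hintikka.

Variable B : seq item.
Hypothesis satB : saturated B.
Hypothesis openB : ~ closed_branch B.

Lemma open_lab f L L' : Lab L f \in B -> Lab L' f \in B -> L = L'.
Proof.
move=> fL fL'; apply/eqP; apply: contra_notT openB => neqL.
by constructor 1; exists f, L, L'.
Qed.

Lemma saturated1 i concls :
  rule [:: i] concls -> i \in B -> has (all [in B]) concls.
Proof. by move=> rl iB; apply: (satB rl); rewrite /= andbT. Qed.

Lemma saturated2 i j c :
  rule [:: i; j] [:: [:: c]] -> i \in B -> j \in B -> c \in B.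
Proof.
move=> rl iB jB; suff: has (all [in B]) [:: [:: c]] by rewrite /= andbT orbF.
by apply: (satB rl); rewrite /= iB jB.
Qed.

Lemma saturated11 i c : rule [:: i] [:: [:: c]] -> i \in B -> c \in B.
Proof. by move=> rl /(saturated1 rl); rewrite /= andbT orbF. Qed.

Lemma sim_sym f g : Sim f g \in B -> Sim g f \in B.
Proof. exact: saturated11 (rule_simSym f g). Qed.

Lemma nsim_sym f g : Nsim f g \in B -> Nsim g f \in B.
Proof. exact: saturated11 (rule_nsimSym f g). Qed.

(** The disjunct [p == q] supplies reflexivity, which no rule yields for a variable occurring in no
    [Sim] item. *)
Definition sim_var p q := (p == q) || (Sim (Var p) (Var q) \in B).

Lemma sim_var_sym p q : sim_var p q -> sim_var q p.
Proof.
by case/orP=> [/eqP ->|/sim_sym pq]; rewrite /sim_var ?eqxx // pq orbT.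
Qed.

Lemma sim_var_trans p q r : sim_var p q -> sim_var q r -> sim_var p r.
Proof.
case/orP=> [/eqP -> //|pq] /orP[/eqP <-|qr]; first by rewrite /sim_var pq orbT.
by rewrite /sim_var (saturated2 (rule_simTrans p q r) pq qr) orbT.
Qed.

(** A canonical member of the class of [p]; being a number, it serves directly as the index of a
    middle element. *)
Definition var_class p := choose (sim_var p) p.

Lemma eq_var_class p q : (var_class p == var_class q) = sim_var p q.
Proof.
have rr r : sim_var r r by rewrite /sim_var eqxx.
apply/eqP/idP => [e|pq].
  apply: (sim_var_trans (chooseP (rr p))); rewrite -/(var_class p) e.
  exact/sim_var_sym/(chooseP (rr q)).
have eq_pq : sim_var p =1 sim_var q.
  move=> r; apply/idP/idP; apply: sim_var_trans => //; exact: sim_var_sym.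
by rewrite /var_class (eq_choose eq_pq); apply: choose_id => //; rewrite -eq_pq.
Qed.

Definition branch_val p :=
  if T_ (Var p) \in B then MTop else
  if F_ (Var p) \in B then MBot else Mid (var_class p).

(** The formula [f] stands on the right because the rules for [And] and [Or] act on that side; the
    symmetry rules cover the left. *)
Definition represents p f : Prop :=
  [/\ eval branch_val f = Mid (var_class p),
      forall g, Sim g f \in B -> Sim g (Var p) \in B
    & forall g, Nsim g f \in B -> Nsim g (Var p) \in B].

Lemma represents_sim p q f g :
  represents p f -> represents q g -> Sim f g \in B ->
  var_class p = var_class q.
Proof.
move=> [_ simp _] [_ simq _] /simq/sim_sym/simp/sim_sym pq.
by apply/eqP; rewrite eq_var_class /sim_var pq orbT.
Qed.

(** The branch contains [Nsim (Var p) (Var q)], so equal classes would close it: by [Nsim] of a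
    variable with itself if [p = q], and by a matching [Sim] otherwise. *)
Lemma represents_nsim p q f g :
  represents p f -> represents q g -> Nsim f g \in B ->
  var_class p != var_class q.
Proof.
move=> [_ _ nsimp] [_ _ nsimq] /nsimq/nsim_sym/nsimp/nsim_sym npq.
rewrite eq_var_class; apply/negP => /orP[/eqP e|pq]; apply: openB.
  by constructor 3; exists (Var p); rewrite {2}e.
by constructor 2; exists (Var p), (Var q).
Qed.

(** The three claims need a joint induction: a true disjunction or a false conjunction may come from
    two middle components, whose representatives then have distinct classes. *)
Lemma truth_lemma f :
  [/\ T_ f \in B -> eval branch_val f = MTop,
      F_ f \in B -> eval branch_val f = MBot
    & M_ f \in B -> exists p, represents p f].
Proof.
elim: f => [p|f [fT fF fM]|f [fT fF fM] g [gT gF gM]|f [fT fF fM] g [gT gF gM]].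
- rewrite /= /branch_val; split=> [->//|pF|pM].
    rewrite pF; case: ifP => // pT; by move: (open_lab pT pF).
  exists p; split=> //=; rewrite /branch_val.
  case: ifP => [pT|_]; first by move: (open_lab pM pT).
  by case: ifP => // pF; move: (open_lab pM pF).
- split=> [/(saturated11 (rule_tNeg f))/fF /= -> //
          |/(saturated11 (rule_fNeg f))/fT /= -> //|].
  (* Negation fixes middle elements, so the representative of [f] also represents [Neg f]. *)
  move=> /(saturated1 (rule_mNeg f)); rewrite /= orbF => /and3P[/fM[p [ev sp np]] _ _].
  exists p; split=> [|h /sim_sym|h /nsim_sym]; first by rewrite /= ev.
    by move/(saturated11 (rule_negSim f h))/sim_sym/sp.
  by move/(saturated11 (rule_negNsim f h))/nsim_sym/np.
- split=> [/(saturated1 (rule_tAnd f g))|/(saturated1 (rule_fAnd f g))|].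
  + by rewrite /= orbF => /and3P[/fT-> /gT->].
  + rewrite /= !andbT !orbF => /or3P[/fF->|/gF->|/and3P[/fM[p rp] /gM[q rq]]] //=.
      by case: (eval _ f).
    move/(represents_nsim rp rq)/negbTE => pq.
    by have [-> _ _] := rp; have [-> _ _] := rq; rewrite meet_Mid pq.
  (* A middle conjunct sharing the value of the conjunction hands over its representative: its label
     [LabM] licenses the rules moving [Sim] and [Nsim] items from the conjunction to it. *)
  + have inhl p : M_ f \in B -> represents p f ->
        eval branch_val (And f g) = eval branch_val f -> represents p (And f g).
      move=> fMB [ev sp np] e; split=> [|h hB|h hB]; first by rewrite e.
        exact/sp/(saturated2 (rule_andSim1 h f g) hB).
      exact/np/(saturated2 (rule_andNsim1 h f g) hB).
    have inhr p : M_ g \in B -> represents p g ->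
        eval branch_val (And f g) = eval branch_val g -> represents p (And f g).
      move=> gMB [ev sp np] e; split=> [|h hB|h hB]; first by rewrite e.
        exact/sp/(saturated2 (rule_andSim2 h f g) hB).
      exact/np/(saturated2 (rule_andNsim2 h f g) hB).
    move=> /(saturated1 (rule_mAnd f g)); rewrite /= !andbT orbF.
    case/or3P=> [/andP[/fT ev gMB]|/andP[fMB /gT ev]|/and3P[fMB /gM[q rq] fg]].
    * have [p rp] := gM gMB; exists p; apply: inhr => //=.
      by have [-> _ _] := rp; rewrite ev.
    * have [p rp] := fM fMB; exists p; apply: inhl => //=.
      by have [-> _ _] := rp; rewrite ev.
    (* Here [Sim f g] forces equal values, so the meet is the value of [f]. *)
    * have [p rp] := fM fMB; exists p; apply: inhl => //=.
      have e := represents_sim rp rq fg.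
      by have [-> _ _] := rp; have [-> _ _] := rq; rewrite meet_Mid e eqxx.
- split=> [/(saturated1 (rule_tOr f g))|/(saturated1 (rule_fOr f g))|].
  + rewrite /= !andbT !orbF => /or3P[/fT->|/gT->|/and3P[/fM[p rp] /gM[q rq]]] //=.
      by case: (eval _ g).
      by case: (eval _ f).
    move/(represents_nsim rp rq)/negbTE => pq.
    by have [-> _ _] := rp; have [-> _ _] := rq; rewrite join_Mid pq.
  + by rewrite /= orbF => /and3P[/fF-> /gF->].
  + have inhl p : M_ f \in B -> represents p f ->
        eval branch_val (Or f g) = eval branch_val f -> represents p (Or f g).
      move=> fMB [ev sp np] e; split=> [|h hB|h hB]; first by rewrite e.
        exact/sp/(saturated2 (rule_orSim1 h f g) hB).
      exact/np/(saturated2 (rule_orNsim1 h f g) hB).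
    have inhr p : M_ g \in B -> represents p g ->
        eval branch_val (Or f g) = eval branch_val g -> represents p (Or f g).
      move=> gMB [ev sp np] e; split=> [|h hB|h hB]; first by rewrite e.
        exact/sp/(saturated2 (rule_orSim2 h f g) hB).
      exact/np/(saturated2 (rule_orNsim2 h f g) hB).
    move=> /(saturated1 (rule_mOr f g)); rewrite /= !andbT orbF.
    case/or3P=> [/andP[/fF ev gMB]|/andP[fMB /gF ev]|/and3P[fMB /gM[q rq] fg]].
    * have [p rp] := gM gMB; exists p; apply: inhr => //=.
      by have [-> _ _] := rp; rewrite ev.
    * have [p rp] := fM fMB; exists p; apply: inhl => //=.
      by have [-> _ _] := rp; rewrite ev.
    * have [p rp] := fM fMB; exists p; apply: inhl => //=.
      have e := represents_sim rp rq fg.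
      by have [-> _ _] := rp; have [-> _ _] := rq; rewrite join_Mid e eqxx.
Qed.

Lemma branch_val_sat L f : Lab L f \in B -> sat branch_val (Lab L f).
Proof.
have [fT fF fM] := truth_lemma f.
by case: L => /=; [move/fT-> | case/fM=> p [-> _ _] | move/fF->].
Qed.

End Hintikka.

(** * Subformula closure and the bound on branches *)

Fixpoint subforms (f : form) : seq form :=
  f :: match f with
       | Var _ => [::]
       | Neg g => subforms g
       | And g h | Or g h => subforms g ++ subforms h
       end.

Lemma mem_subforms f : f \in subforms f.
Proof. by case: f => *; rewrite /= inE eqxx. Qed.

Lemma subforms_trans f g : g \in subforms f -> {subset subforms g <= subforms f}.
Proof.
elim: f => [p|f IH|f IHf h IHh|f IHf h IHh]; rewrite /= in_cons.
- by rewrite in_nil orbF => /eqP ->.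
- by case/orP=> [/eqP -> //|/IH gf x /gf]; rewrite in_cons => ->; rewrite orbT.
- rewrite mem_cat => /or3P[/eqP -> //|/IHf gf|/IHh gf] x /gf;
    by rewrite in_cons mem_cat => ->; rewrite ?orbT.
- rewrite mem_cat => /or3P[/eqP -> //|/IHf gf|/IHh gf] x /gf;
    by rewrite in_cons mem_cat => ->; rewrite ?orbT.
Qed.

Definition item_over (S : seq form) (i : item) : bool :=
  match i with
  | Lab _ f => f \in S
  | Sim f g | Nsim f g => (f \in S) && (g \in S)
  end.

(** Its length bounds the number of distinct items on a branch over [S], which yields the
    termination measure. *)
Definition items_over (S : seq form) : seq item :=
  map T_ S ++ map M_ S ++ map F_ S ++
  [seq Sim f g | f <- S, g <- S] ++ [seq Nsim f g | f <- S, g <- S].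

Lemma mem_items_over S i : item_over S i -> i \in items_over S.
Proof.
rewrite /items_over !mem_cat; case: i => [L f fS|f g /andP[fS gS]|f g /andP[fS gS]].
- by case: L fS => fS; rewrite (map_f _ fS) ?orbT.
- by rewrite (allpairs_f Sim fS gS) !orbT.
- by rewrite (allpairs_f Nsim fS gS) !orbT.
Qed.

Definition subform_closed (S : seq form) : Prop :=
  forall f, f \in S -> {subset subforms f <= S}.

Lemma rule_item_over S prems concls :
  subform_closed S -> rule prems concls -> all (item_over S) prems ->
  all (all (item_over S)) concls.
Proof.
move=> clS.
have SNeg f : Neg f \in S -> f \in S.
  by move/clS; apply; rewrite /= inE mem_subforms orbT.
have SAnd f g : And f g \in S -> f \in S /\ g \in S.
  by move/clS => sub; split; apply: sub; rewrite /= inE mem_cat mem_subforms ?orbT.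
have SOr f g : Or f g \in S -> f \in S /\ g \in S.
  by move/clS => sub; split; apply: sub; rewrite /= inE mem_cat mem_subforms ?orbT.
move=> rl; apply/implyP; case: rl => * /=; apply/implyP; rewrite !andbT;
  repeat match goal with
  | |- is_true (_ && _) -> _ => case/andP
  (* Membership of the compound itself is used as well, since [rule_mNeg] repeats [Neg phi] in its
     conclusion. *)
  | |- is_true (Neg ?f \in S) -> _ =>
      let h := fresh in move=> h; rewrite ?h; move/SNeg: h => ->
  | |- is_true (And ?f ?g \in S) -> _ =>
      let h := fresh in move=> h; rewrite ?h; case/SAnd: h => -> ->
  | |- is_true (Or ?f ?g \in S) -> _ =>
      let h := fresh in move=> h; rewrite ?h; case/SOr: h => -> ->
  | |- is_true (_ \in S) -> _ => move=> ->
  end => //.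
Qed.

(** This keeps a node extended by a rule from being read as a leaf by [branches]. *)
Lemma rule_concls_nonempty prems concls : rule prems concls -> concls != [::].
Proof. by case. Qed.

Lemma size_undup_new (B c : seq item) :
  ~~ all [in B] c -> size (undup B) < size (undup (B ++ c)).
Proof.
case/allPn=> i ic iB; apply: (@uniq_leq_size _ (i :: undup B)).
  by rewrite /= mem_undup iB undup_uniq.
move=> j; rewrite inE !mem_undup mem_cat => /orP[/eqP ->|->] //.
by rewrite ic orbT.
Qed.

(** * Construction of closed tableaux *)

Definition is_lab (i : item) : bool := if i is Lab _ _ then true else false.

(** Induction on the number of items over [S] missing from the branch. Unsatisfiability is assumed
    of the labelled formulas alone, because [branch_val_sat] covers only these. *)
Lemma closed_tableau_above S B s :
  subform_closed S -> all (item_over S) (B ++ s) ->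
  (forall v, ~~ all (sat v) (filter is_lab (B ++ s))) ->
  exists t, [/\ contents t = s, expansion B t
    & forall b, b \in branches t -> closed_branch (B ++ b)].
Proof.
move=> clS.
have [n] := ubnP (size (items_over S) - size (undup (B ++ s))).
elim: n B s => // n IH B s le_n overBs unsat.
have leaf : closed_branch (B ++ s) -> exists t, [/\ contents t = s, expansion B t
    & forall b, b \in branches t -> closed_branch (B ++ b)].
  move=> cl; exists (Node s [::]); split=> //=; first by split=> //; left.
  by move=> b; rewrite inE => /eqP ->.
case: (classic (closed_branch (B ++ s))) => [/leaf //|open].
case: (classic (saturated (B ++ s))) => [satBs|nsat].
  case/negP: (unsat (branch_val (B ++ s))); apply/allP => i.
  rewrite mem_filter => /andP[]; case: i => // L f _; exact: branch_val_sat.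
(* Failure of saturation gives an applicable rule none of whose alternatives is already contained in
   the branch, so every child makes progress. *)
have [prems [concls [rl prB new]]] : exists prems concls,
    [/\ rule prems concls, all [in B ++ s] prems
      & ~~ has (all [in B ++ s]) concls].
  apply: NNPP => none; apply: nsat => prems concls rl prB.
  by apply: contra_notT none => new; exists prems, concls.
have overC := rule_item_over clS rl
  (introT allP (fun i ip => allP overBs i (allP prB i ip))).
have [ts [contsE exp_ts cl_ts]] : exists ts, [/\ map contents ts = concls,
    foldr (fun u P => expansion (B ++ s) u /\ P) True ts
  & forall b, b \in flatten (map branches ts) -> closed_branch ((B ++ s) ++ b)].
  elim: concls new overC {rl} => [|c cs IHcs]; first by exists [::].
  rewrite /= negb_or => /andP[newc /IHcs IHnew] /andP[overc /IHnew].
  case=> ts [contsE exp_ts cl_ts].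
  have over' : all (item_over S) ((B ++ s) ++ c) by rewrite all_cat overBs.
  have [|//|v|t [contE exp_t cl_t]] := IH (B ++ s) c.
  - have lt := size_undup_new newc.
    (* Subtraction is truncated, so this bound is what makes the measure drop strictly. *)
    have le : size (undup ((B ++ s) ++ c)) <= size (items_over S).
      apply: uniq_leq_size; first exact: undup_uniq.
      by move=> i; rewrite mem_undup => /(allP over'); apply: mem_items_over.
    exact: leq_trans (ltn_sub2l (leq_trans lt le) lt) le_n.
  - by rewrite filter_cat all_cat negb_and unsat.
  exists (t :: ts); split=> //=; first by rewrite contE contsE.
  by move=> b; rewrite mem_cat => /orP[/cl_t|/cl_ts].
exists (Node s ts); split=> //=.
  split=> //; right; exists prems; last by rewrite contsE.
  exact/allP.
case: ts contsE cl_ts {exp_ts} => [|u us] contsE cl_ts.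
  by move: (rule_concls_nonempty rl); rewrite -contsE.
by move=> b /mapP[b' /cl_ts cl ->]; rewrite catA.
Qed.

Lemma closed_tableau_exists L L' f g :
  (forall v, ~~ all (sat v) [:: Lab L f; Lab L' g]) ->
  exists t, tableau_for [:: Lab L f; Lab L' g] t /\ closed_tableau t.
Proof.
move=> unsat; pose S := subforms f ++ subforms g.
have clS : subform_closed S.
  move=> h; rewrite mem_cat => /orP[] hS x /(subforms_trans hS);
    by rewrite mem_cat => ->; rewrite ?orbT.
have overS : all (item_over S) ([::] ++ [:: Lab L f; Lab L' g]).
  by rewrite /= !mem_cat !mem_subforms orbT.
have [//|t [contE exp_t cl_t]] := closed_tableau_above clS overS.
by exists t.
Qed.

Theorem theorem7 (phi chi : form) :
  ETL_entails phi chi <-> tableaux_proof phi chi.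
Proof.
split=> [ent|[[t1 [tab1 cl1]] [t2 [tab2 cl2]]] v phiT].
  have unsat L : L != LabT -> forall v, ~~ all (sat v) [:: T_ phi; Lab L chi].
    move=> LT v; rewrite /= andbT; apply/negP => /andP[phiT chiL].
    have /ent chiT : eval v phi = MTop.
      by case: (eval v phi) phiT => [||n] //; rewrite label_eqE.
    by move: chiL LT; rewrite chiT eq_sym => ->.
  by split; apply: closed_tableau_exists; apply: unsat; rewrite label_eqE.
(* The two tableaux exclude a middle value and bottom for [chi], leaving only top. *)
have := closed_tableau_unsat v tab1 cl1; have := closed_tableau_unsat v tab2 cl2.
by rewrite /= phiT !label_eqE; case: (eval v chi).
Qed.
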